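(* Let $(R,D)$ be a second-order regular overdetermined system of codimension $2$ with $2$ independent and $1$ dependent variables, of one of the types (I), (II), (III), (IV). Let $\Sigma(R)$ be its rank $2$ prolongation and $R^{(1)}\subset\Sigma(R)$ its prolongation with the transversality condition. Then $R^{(1)}=\Sigma(R)$ if and only if $(R,D)$ is of type (II) or (III), and $R^{(1)}\neq\Sigma(R)$ if and only if $(R,D)$ is of type (I) or (IV).
   Context: Let $J^1(\mathbb R^2,\mathbb R)=\{(x,y,z,p,q)\}$, $J^2(\mathbb R^2,\mathbb R)=\{(x,y,z,p,q,r,s,t)\}$, let $\pi^2_1:J^2\to J^1$ be the natural projection, and let $C^2$ be the canonical system on $J^2$ defined by $\varpi_0=\varpi_1=\varpi_2=0$ with $\varpi_0=dz-p\,dx-q\,dy$, $\varpi_1=dp-r\,dx-s\,dy$, $\varpi_2=dq-s\,dx-t\,dy$. A second-order regular overdetermined system (codimension $2$, with $2$ independent and $1$ dependent variables) is a non-empty subset $R=\{F=G=0\}\subset J^2$, with $F,G$ smooth, such that $(F_r,F_s,F_t)$ and $(G_r,G_s,G_t)$ are linearly independent on $R$, together with $D=C^2|_R$. Then $R$ is a $6$-dimensional manifold, $\pi^2_1|_R:R\to J^1$ is a submersion, and $D$ is a rank $3$ subbundle of $TR$. Types. $(R,D)$ is of type (I), (II), (III) or (IV) if around every $w\in R$ there is a coframe $\{\varpi_0,\varpi_1,\varpi_2,\omega_1,\omega_2,\pi\}$ of $R$, with $\varpi_0$ the restriction to $R$ of $dz-p\,dx-q\,dy$ and $D=\{\varpi_0=\varpi_1=\varpi_2=0\}$,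 such that at $w$ one has $d\varpi_0\equiv\omega_1\wedge\varpi_1+\omega_2\wedge\varpi_2 \pmod{\varpi_0}$ and, modulo $\varpi_0,\varpi_1,\varpi_2$: (I) (involutive type) $d\varpi_1\equiv 0$, $d\varpi_2\equiv\omega_2\wedge\pi$; (II) (finite type) $d\varpi_1\equiv\omega_2\wedge\pi$, $d\varpi_2\equiv\omega_1\wedge\pi$; (III) (finite type) $d\varpi_1\equiv\omega_1\wedge\pi$, $d\varpi_2\equiv\omega_2\wedge\pi$; (IV) (torsion type) $d\varpi_1\equiv\omega_1\wedge\omega_2$, $d\varpi_2\equiv\omega_2\wedge\pi$. Prolongations. A $2$-dimensional integral element of $D=\{\theta_1=\dots=\theta_s=0\}$ at $x\in R$ is a $2$-dimensional subspace $v\subset D(x)$ with $d\theta_i|_v=0$ for all $i$. The rank $2$ prolongation is $\Sigma(R)=\bigcup_{x\in R}\Sigma_x$, where $\Sigma_x$ is the set of all $2$-dimensional integral elements of $D$ at $x$. The prolongation with the transversality condition is $R^{(1)}=\bigcup_{x\in R}R^{(1)}_x$, where $R^{(1)}_x$ is the set of those $v\in\Sigma_x$ that are transversal to $\operatorname{Ker}(\pi^2_1|_R)_*$ (i.e. $v\cap\operatorname{Ker}(\pi^2_1|_R)_*=0$). *)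

(* Defs.v *)
From HB Require Import structures.
From mathcomp Require Import all_boot all_order all_algebra.
From mathcomp Require Import all_classical all_reals.
From mathcomp Require Import topology normedtype derive.

Set Implicit Arguments.
Unset Strict Implicit.
Unset Printing Implicit Defensive.

Import Order.TTheory GRing.Theory Num.Theory.
Import numFieldNormedType.Exports.

Local Open Scope classical_set_scope.
Local Open Scope ring_scope.

(* The jet spaces, in the coordinates (x, y, z, p, q) and
   (x, y, z, p, q, r, s, t).  A row vector is a point of J^2 or a tangent
   vector of J^2; a cotangent vector is a column vector. *)
Notation J1 R := 'rV[R]_5.
Notation J2 R := 'rV[R]_8.
Notation covector R := 'cV[R]_8.

Definition ix : 'I_8 := @Ordinal 8 0 isT.
Definition iy : 'I_8 := @Ordinal 8 1 isT.
Definition iz : 'I_8 := @Ordinal 8 2 isT.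
Definition ip : 'I_8 := @Ordinal 8 3 isT.
Definition iq : 'I_8 := @Ordinal 8 4 isT.
Definition ir : 'I_8 := @Ordinal 8 5 isT.
Definition is_ : 'I_8 := @Ordinal 8 6 isT.
Definition it : 'I_8 := @Ordinal 8 7 isT.

Definition pi21 (R : realType) (w : J2 R) : J1 R :=
  \row_(i < 5) w 0 (widen_ord (isT : (5 <= 8)%N) i).

Definition partial (R : realType) (i : 'I_8) (f : J2 R -> R) : J2 R -> R :=
  fun w => 'D_(delta_mx 0 i) f w.

(* C^infinity on the open set U: all iterated partial derivatives exist and
   are differentiable (hence continuous) on U. *)
Definition smooth_on (R : realType) (U : set (J2 R)) (f : J2 R -> R) : Prop :=
  forall (l : seq 'I_8) (w : J2 R), U w ->
    differentiable (foldr (@partial R) f l) w.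

Definition ev (R : realType) (a : covector R) (v : J2 R) : R := (v *m a) 0 0.

Definition annihilated (R : realType) (a : covector R) : {vspace J2 R} :=
  lker (linfun (mulmxr a : J2 R -> 'M[R]_1)).

Definition two_form (R : realType) := J2 R -> J2 R -> R.

Definition wedge (R : realType) (a b : covector R) : two_form R :=
  fun u v => ev a u * ev b v - ev a v * ev b u.

Definition one_form (R : realType) := J2 R -> covector R.

Definition smooth_form_on (R : realType) (U : set (J2 R)) (a : one_form R) :=
  forall i : 'I_8, smooth_on U (fun w => a w i 0).

Definition differential (R : realType) (f : J2 R -> R) : one_form R :=
  fun w => \col_i partial i f w.

(* (da)(X, Y) = X(a(Y)) - Y(a(X)) - a([X, Y]) for the constant vector fields
   X = u and Y = v, whose bracket vanishes. *)
Definition ext_d (R : realType) (a : one_form R) (w : J2 R) : two_form R :=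
  fun u v => 'D_u (fun y => ev (a y) v) w - 'D_v (fun y => ev (a y) u) w.

Definition dcoord (R : realType) (i : 'I_8) : covector R := delta_mx i 0.

Section canonical_forms.
Variable R : realType.
Local Notation d := (@dcoord R).

Definition contact0 : one_form R :=
  fun w => d iz - w 0 ip *: d ix - w 0 iq *: d iy.
Definition contact1 : one_form R :=
  fun w => d ip - w 0 ir *: d ix - w 0 is_ *: d iy.
Definition contact2 : one_form R :=
  fun w => d iq - w 0 is_ *: d ix - w 0 it *: d iy.

End canonical_forms.

Section systems.
Variables (R : realType) (F G : J2 R -> R).

Definition locus : set (J2 R) := [set w | F w = 0 /\ G w = 0].

Definition fibre_gradient (f : J2 R -> R) (w : J2 R) : 'rV[R]_3 :=
  \row_(i < 3) partial (tnth [tuple ir; is_; it] i) f w.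

Definition regular_system : Prop :=
  [/\ smooth_on setT F, smooth_on setT G, locus !=set0 &
      forall w, locus w -> free [:: fibre_gradient F w; fibre_gradient G w]].

(* The tangent space of the submanifold {F = G = 0}, inside the tangent space
   of J^2. *)
Definition tangent (w : J2 R) : {vspace J2 R} :=
  (annihilated (differential F w) :&: annihilated (differential G w))%VS.

Definition Dspace (w : J2 R) : {vspace J2 R} :=
  (tangent w :&: (annihilated (contact0 w) :&:
    (annihilated (contact1 w) :&: annihilated (contact2 w))))%VS.

Definition ker_pi21 (w : J2 R) : {vspace J2 R} :=
  (tangent w :&: lker (linfun ('d (@pi21 R) w)))%VS.

(* The restrictions of the covectors es to the subspace T form a basis of the
   dual of T (every linear form on T extends to the whole space). *)
Definition dual_basis_of (T : {vspace J2 R}) (es : seq (covector R)) : Prop :=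
  forall a : covector R, exists! c : 'rV[R]_(size es),
    forall v, v \in T -> ev a v = \sum_(i < size es) c 0 i * ev es`_i v.

(* The restrictions to T of two 2-forms are congruent modulo the ideal
   generated by the restrictions of the covectors es. *)
Definition eq_mod (T : {vspace J2 R}) (es : seq (covector R))
    (A B : two_form R) : Prop :=
  exists b : 'I_(size es) -> covector R, forall u v, u \in T -> v \in T ->
    A u v = B u v + \sum_(i < size es) wedge (b i) es`_i u v.

Inductive system_type := TypeI | TypeII | TypeIII | TypeIV.

Definition structure1 (k : system_type) (o1 o2 pi : covector R) : two_form R :=
  match k with
  | TypeI => fun _ _ => 0
  | TypeII => wedge o2 pi
  | TypeIII => wedge o1 pi
  | TypeIV => wedge o1 o2
  end.

Definition structure2 (k : system_type) (o1 o2 pi : covector R) : two_form R :=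
  match k with
  | TypeI => wedge o2 pi
  | TypeII => wedge o1 pi
  | TypeIII => wedge o2 pi
  | TypeIV => wedge o2 pi
  end.

(* Since {F = G = 0} is an embedded submanifold, a smooth 1-form on it near w
   is the restriction of a smooth 1-form on a neighbourhood U of w in J^2, and
   restriction commutes with the exterior derivative.  Accordingly, forms on
   the submanifold are given by such extensions, and only their values on
   tangent vectors of the submanifold are used. *)
Definition of_type (k : system_type) : Prop :=
  forall w, locus w ->
  exists (U : set (J2 R)) (w1 w2 o1 o2 pi : one_form R),
  let w0 := @contact0 R in
  [/\ open U /\ U w,
      [/\ smooth_form_on U w1, smooth_form_on U w2, smooth_form_on U o1,
          smooth_form_on U o2 & smooth_form_on U pi],
      forall y, locus y -> U y ->
        dual_basis_of (tangent y) [:: w0 y; w1 y; w2 y; o1 y; o2 y; pi y],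
      forall y, locus y -> U y ->
        Dspace y = (tangent y :&: (annihilated (w0 y) :&:
          (annihilated (w1 y) :&: annihilated (w2 y))))%VS &
      [/\ eq_mod (tangent w) [:: w0 w] (ext_d w0 w)
            (fun u v => wedge (o1 w) (w1 w) u v + wedge (o2 w) (w2 w) u v),
          eq_mod (tangent w) [:: w0 w; w1 w; w2 w] (ext_d w1 w)
            (structure1 k (o1 w) (o2 w) (pi w)) &
          eq_mod (tangent w) [:: w0 w; w1 w; w2 w] (ext_d w2 w)
            (structure2 k (o1 w) (o2 w) (pi w))]].

Definition vanishes_on (v : {vspace J2 R}) (A : two_form R) : Prop :=
  forall a b, a \in v -> b \in v -> A a b = 0.

Definition integral_element (w : J2 R) (v : {vspace J2 R}) : Prop :=
  [/\ (v <= Dspace w)%VS, \dim v = 2%N, vanishes_on v (ext_d (@contact0 R) w),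
      vanishes_on v (ext_d (@contact1 R) w) &
      vanishes_on v (ext_d (@contact2 R) w)].

(* The integral elements are recorded together with their base points. *)
Definition rank2_prolongation : set (J2 R * {vspace J2 R}) :=
  [set e | locus e.1 /\ integral_element e.1 e.2].

Definition transversal_prolongation : set (J2 R * {vspace J2 R}) :=
  [set e | rank2_prolongation e /\ (e.2 :&: ker_pi21 e.1)%VS = 0%VS].

End systems.

(* Main.v *)
From HB Require Import structures.
Require Import Defs.
From mathcomp Require Import all_boot all_order all_algebra.
From mathcomp Require Import all_classical all_reals.
From mathcomp Require Import topology normedtype derive.
From mathcomp Require Import perm landau sequences interval_inference ring lra.

(** Let [e] span the vertical line [Ker (pi21)_*] of the locus at a point [w].
  The equation for [d w0] forces [o1 e = o2 e = 0], so [o1], [o2] and [pi] are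
  coordinates on [D w] in which [e] is the [pi]-axis.  In types (II) and (III)
  the structure equations say that a vector completing [e] to an integral
  element satisfies [o1 = o2 = 0], hence is proportional to [e]: no integral
  element contains [e].  In types (I) and (IV) the plane [o2 = 0] of [D w] is
  an integral element containing [e].

  The structure equations concern an arbitrary coframe, whereas integral
  elements are defined by the contact forms.  If a 1-form [a] vanishes on [D]
  along the locus, then [da (u, v) = - a B] for [u, v] in [D w], where [B], the
  bracket of two sections of [D] extending [u] and [v], is tangent to the locus
  and independent of [a].  So, as soon as [d w0 (u, v) = 0], the vanishing of
  the remaining two differentials at [(u, v)] means [B \in D w], whichever
  forms are used to define [D].  This needs the derivative, along a vector
  tangent to the locus, of a function vanishing on the locus to be zero, which
  is Lyusternik's theorem, proved by Banach's fixed point theorem. *)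

Set Implicit Arguments.
Unset Strict Implicit.
Unset Printing Implicit Defensive.

Import Order.TTheory GRing.Theory Num.Theory.
Import numFieldNormedType.Exports.

Local Open Scope classical_set_scope.
Local Open Scope ring_scope.

(** * Differential calculus *)

Lemma differentiable_expansion (R : realType) (V W : normedModType R)
    (f : V -> W) (x : V) : differentiable f x ->
  forall e, 0 < e ->
    \forall h \near 0, `|f (x + h) - f x - 'D_h f x| <= e * `|h|.
Proof.
move=> df e e0; have /diff_locallyP[_ /eqaddoP/(_ e e0)] := df.
apply: filterS => h /=; rewrite !fctE /= (deriveE _ df) opprD addrA.
by rewrite (addrC h).
Qed.

Lemma derive_along_line (R : realType) (V W : normedModType R)
    (f : V -> W) (x v : V) (t : R) : differentiable f (x + t *: v) ->
  is_derive t 1 (fun s => f (x + s *: v)) ('D_v f (x + t *: v)).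
Proof.
move=> df.
have dl : is_diff t (fun s : R => x + s *: v) (fun s => s *: v).
  have -> : (fun s : R => x + s *: v) = cst x + *:%R^~ v by [].
  apply: is_diff_eq; by rewrite add0r.
have dc := is_diff_comp dl (differentiableP df).
apply: DeriveDef; first exact/diff_derivable.
by rewrite deriveE // diff_val /= scale1r deriveE.
Qed.

Lemma mean_value_segment (R : realType) (V : normedModType R)
    (f : V -> R) (x v : V) :
  (forall t : R, 0 <= t <= 1 -> differentiable f (x + t *: v)) ->
  exists2 c : R, 0 < c < 1 & f (x + v) - f x = 'D_v f (x + c *: v).
Proof.
move=> df; pose g (s : R) := f (x + s *: v).
have dg (t : R) : 0 <= t <= 1 -> is_derive t 1 g ('D_v f (x + t *: v)).
  by move=> /df; exact: derive_along_line.
have [||c c01] := @MVT R g (fun t => 'D_v f (x + t *: v)) 0 1 ltr01.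
- by move=> t; rewrite in_itv/= => /andP[t0 t1]; apply: dg; rewrite !ltW.
- apply: derivable_within_continuous => t; rewrite in_itv/= => /dg dgt.
  exact: ex_derive.
rewrite /g !scale1r scale0r addr0 subr0 mulr1 => ->; exists c => //.
Qed.

(** * Strict derivatives on row vectors and Lyusternik's theorem *)

Lemma normr_coord_le (R : realType) n (v : 'rV[R]_n) i : `|v 0 i| <= `|v|.
Proof.
rewrite [leRHS]/Num.norm/= mx_normrE.
exact: (le_bigmax _ (fun ij => `|v ij.1 ij.2|) (0, i)).
Qed.

Lemma derive_row_sum_delta (R : realType) n (f : 'rV[R]_n -> R)
    (w v : 'rV[R]_n) :
  differentiable f w ->
  'D_v f w = \sum_(i < n) v 0 i * 'D_(delta_mx 0 i) f w.
Proof.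
move=> df; rewrite (deriveE _ df) {1}(row_sum_delta v) linear_sum.
by apply: eq_bigr => i _; rewrite linearZ /= deriveE.
Qed.

(** Differentiability in the strict (Peano) sense: both points move, so [f - L] has arbitrarily
    small Lipschitz constants near [w]. This is what a contraction argument requires. *)
Definition strict_derivative (R : realType) (V : normedModType R)
    (f : V -> R) (w : V) (L : V -> R) :=
  forall e, 0 < e -> exists2 d, 0 < d & forall y z,
    `|w - y| < d -> `|w - z| < d ->
    `|f y - f z - L (y - z)| <= e * `|y - z|.

(** By the mean value theorem on the segment from [z] to [y], the error is the value on [y - z] of
    the difference between the derivatives at an intermediate point and at [w]. Continuity of the
    partial derivatives makes it small. *)
Lemma strict_derivative_rV (R : realType) n (f : 'rV[R]_n -> R) (w : 'rV[R]_n) :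
  (\forall y \near w, differentiable f y) ->
  (forall i, {for w, continuous ('D_(delta_mx 0 i) f)}) ->
  strict_derivative f w ('d f w).
Proof.
(* Each of the [n] coordinates contributes at most this share of [e]; the successor keeps the
   denominator nonzero when [n = 0]. *)
move=> df cf e e0; have e0' : 0 < e / n.+1%:R by rewrite divr_gt0.
have cf' : \forall y \near w, forall i,
    `|'D_(delta_mx 0 i) f w - 'D_(delta_mx 0 i) f y| <= e / n.+1%:R.
  apply: (@filter_forall _ _ (fun i y => `|'D_(delta_mx 0 i) f w -
    'D_(delta_mx 0 i) f y| <= e / n.+1%:R) (nbhs w)) => i.
  exact: (cvgr_dist_le _ _ (cf i) _ e0').
have /nbhs_ballP[d /= d0 H] : nbhs w [set y | differentiable f y /\ forall i,
    `|'D_(delta_mx 0 i) f w - 'D_(delta_mx 0 i) f y| <= e / n.+1%:R].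
  exact: filterI.
exists d => // y z wy wz.
have wseg t : 0 <= t <= 1 -> `|w - (z + t *: (y - z))| < d.
  move=> /andP[t0 t1].
  have -> : w - (z + t *: (y - z)) = t *: (w - y) + (1 - t) *: (w - z).
    by apply/rowP => i; rewrite !mxE; ring.
  rewrite (le_lt_trans (ler_normD _ _))// !normrZ.
  rewrite ger0_norm// ger0_norm ?subr_ge0//.
  (* The strict bound on the convex combination comes from the first term, so [t = 0] is treated
     apart. *)
  move: t0; rewrite le_eqVlt => /predU1P[<-|t0].
    by rewrite mul0r add0r subr0 mul1r.
  have -> : d = t * d + (1 - t) * d by ring.
  by rewrite ltr_leD// ?ltr_pM2l// ler_wpM2l ?subr_ge0// ltW.
have [|c c01] := @mean_value_segment R _ f z (y - z).
  move=> t t01; have /H[] // : ball w d (z + t *: (y - z)).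
  by rewrite -ball_normE /=; exact: wseg.
rewrite subrKC => ->; set x := z + _.
have /H[dfx cfx] : ball w d x.
  by rewrite -ball_normE; apply: wseg; case/andP: c01 => ? ?; rewrite !ltW.
have /H[dfw _] : ball w d w by exact: ballxx.
rewrite -deriveE// !derive_row_sum_delta// -sumrB.
rewrite (le_trans (ler_norm_sum _ _ _))//.
rewrite (@le_trans _ _ (\sum_(i < n) `|y - z| * (e / n.+1%:R)))//.
  apply: ler_sum => i _; rewrite -mulrBr normrM ler_pM//.
    exact: normr_coord_le.
  by rewrite distrC cfx.
rewrite sumr_const card_ord -mulrnAr mulrC ler_wpM2r// -mulr_natr mulrAC.
by rewrite ler_pdivrMr// ler_wpM2l ?ltW// ltr_nat.
Qed.

(* The library provides both structures on matrices, but not their join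
   [completeNormedModType], which Banach's fixed point theorem needs. *)
HB.instance Definition _ (R : realType) (m n : nat) := Complete.on 'M[R]_(m, n).

(** Lyusternik's theorem: [w + t *: u] is corrected to a common zero by a vector of size [o(t)] in
    the span of [a] and [b], which are dual to [LF] and [LG]. The correction solves a fixed point
    equation in the nonlinear remainders of [F] and [G]. *)
Lemma tangent_to_common_zeros (R : realType) (n : nat)
    (F G : 'rV[R]_n -> R) (w a b u : 'rV[R]_n)
    (LF LG : {linear 'rV[R]_n -> R}) :
  strict_derivative F w LF -> strict_derivative G w LG ->
  F w = 0 -> G w = 0 -> LF a = 1 -> LG a = 0 -> LF b = 0 -> LG b = 1 ->
  LF u = 0 -> LG u = 0 ->
  forall e, 0 < e -> exists2 d, 0 < d & forall t, 0 < t < d ->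
    exists y, [/\ F y = 0, G y = 0 & `|w + t *: u - y| <= e * t].
Proof.
move=> sF sG Fw Gw Fa Ga Fb Gb Fu Gu e e0.
set K := `|a| + `|b| + 1; have K0 : 0 < K by rewrite ltr_wpDl ?addr_ge0.
set N := `|u| + e; have N0 : 0 < N by rewrite ltr_wpDl.
(* The first bound makes [T] below a contraction of ratio 1/2. The second makes [T] preserve the
   ball [U] of radius [e * t], whose points lie within [t * N] of [w]. *)
pose h := Num.min (1 / (2 * K)) (e / (K * N)).
have h0 : 0 < h by rewrite lt_min !divr_gt0 ?mulr_gt0.
have hK : h * K <= 1 / 2.
  by rewrite -ler_pdivlMr// ge_min -mulrA -invfM lexx.
have hKN : h * K * N <= e.
  by rewrite -mulrA -ler_pdivlMr ?mulr_gt0// ge_min lexx orbT.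
have [d1 d10 HF] := sF h h0; have [d2 d20 HG] := sG h h0.
pose rho := Num.min d1 d2; have rho0 : 0 < rho by rewrite lt_min d10.
exists (rho / N); first by rewrite divr_gt0.
move=> t /andP[t0]; rewrite ltr_pdivlMr// => tN.
pose c := w + t *: u; pose U := closed_ball c (e * t).
have et0 : 0 < e * t by rewrite mulr_gt0.
have UE y : U y <-> `|c - y| <= e * t by rewrite /U closed_ballE.
have Uw y : U y -> `|w - y| <= t * N.
  move=> /UE cy; have -> : w - y = (c - y) - t *: u.
    by rewrite /c [w + _ - y]addrAC addrK.
  rewrite (le_trans (ler_normB _ _))// normrZ gtr0_norm// /N mulrDr addrC.
  by rewrite lerD2l mulrC.
have Urho y : U y -> `|w - y| < rho by move=> /Uw /le_lt_trans; apply.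
pose rF y := F y - LF (y - w); pose rG y := G y - LG (y - w).
have LB (L : {linear 'rV[R]_n -> R}) y z : L (y - w) - L (z - w) = L (y - z).
  by rewrite -linearB /= opprB addrA subrK.
have rFl y z : `|w - y| < rho -> `|w - z| < rho ->
    `|rF y - rF z| <= h * `|y - z|.
  rewrite !lt_min => /andP[y1 _] /andP[z1 _].
  rewrite /rF opprD addrACA -opprD LB; exact: HF.
have rGl y z : `|w - y| < rho -> `|w - z| < rho ->
    `|rG y - rG z| <= h * `|y - z|.
  rewrite !lt_min => /andP[_ y1] /andP[_ z1].
  rewrite /rG opprD addrACA -opprD LB; exact: HG.
have ww : `|w - w| < rho by rewrite subrr normr0.
have rFw : rF w = 0 by rewrite /rF Fw subrr linear0 subr0.
have rGw : rG w = 0 by rewrite /rG Gw subrr linear0 subr0.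
(* A fixed point of [T] is a common zero of [F] and [G]: apply [LF] and [LG]. *)
pose T y := c - (rF y *: a + rG y *: b).
have corr y z : `|w - y| < rho -> `|w - z| < rho ->
    `|(rF y *: a + rG y *: b) - (rF z *: a + rG z *: b)| <= h * K * `|y - z|.
  move=> yw zw.
  rewrite opprD addrACA -!scalerBl (le_trans (ler_normD _ _))// !normrZ.
  rewrite (@le_trans _ _ (h * `|y - z| * `|a| + h * `|y - z| * `|b|))//.
    by rewrite lerD// ler_wpM2r// ?rFl ?rGl.
  rewrite -mulrDr mulrAC ler_wpM2r// ler_wpM2l ?(ltW h0)//.
  by rewrite lerDl.
(* The remainders vanish at [w], so the estimate [corr] between [y] and [w] bounds [T y - c] by
   [h * K * (t * N)]. *)
have Tfun : set_fun U U T.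
  move=> y Uy; apply/UE; rewrite /T opprB addrCA subrr addr0.
  have := corr y w (Urho _ Uy) ww.
  rewrite rFw rGw !scale0r addr0 subr0 => /le_trans; apply.
  rewrite (@le_trans _ _ (h * K * (t * N)))//.
    by rewrite ler_wpM2l ?mulr_ge0 ?(ltW h0) ?(ltW K0)// distrC Uw.
  by rewrite mulrCA mulrC ler_wpM2r// ltW.
have [|||y Uy] := @banach_fixed_point R 'rV[R]_n U (mkfun_fun Tfun).
- exists (1 / 2)%:nng; split; first by rewrite /= ltr_pdivrMr// mul1r ltrDl.
  move=> [y z] [/= /Urho yw /Urho zw].
  rewrite /mkfun_fun /mkfun /T opprB addrC addrA subrK distrC.
  by rewrite (le_trans (corr _ _ yw zw))// ler_wpM2r.
- exact: closed_ball_closed.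
- by exists c; apply/UE; rewrite subrr normr0 ltW.
rewrite /mkfun_fun /mkfun /T => yE; exists y.
have yw : y - w = t *: u - (rF y *: a + rG y *: b).
  by rewrite {1}yE /c addrAC (addrC w) addrK addrC.
split; last exact/UE.
- have := congr1 LF yw; rewrite [RHS]linearB [LF (_ *: _ + _)]linearD.
  rewrite !linearZ /= Fu Fa Fb.
  rewrite /rF !scaler0 addr0 -[_%:A]/(_ * 1) mulr1; lra.
- have := congr1 LG yw; rewrite [RHS]linearB [LG (_ *: _ + _)]linearD.
  rewrite !linearZ /= Gu Ga Gb.
  rewrite /rG !scaler0 add0r -[_%:A]/(_ * 1) mulr1; lra.
Qed.

(** At a common zero [y] within [o(t)] of [w + t *: u], both [h y] and [h w] vanish, so the
    first-order expansion of [h] gives [t * 'D_u h w = o(t)]. *)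
Lemma derive_zero_on_common_zeros (R : realType) (n : nat)
    (F G h : 'rV[R]_n -> R) (w a b u : 'rV[R]_n)
    (LF LG : {linear 'rV[R]_n -> R}) :
  strict_derivative F w LF -> strict_derivative G w LG ->
  F w = 0 -> G w = 0 -> LF a = 1 -> LG a = 0 -> LF b = 0 -> LG b = 1 ->
  LF u = 0 -> LG u = 0 ->
  differentiable h w -> (\forall y \near w, F y = 0 -> G y = 0 -> h y = 0) ->
  'D_u h w = 0.
Proof.
move=> sF sG Fw Gw Fa Ga Fb Gb Fu Gu dh h0.
have hw : h w = 0 by exact: (nbhs_singleton h0).
have [M M0 HM] := linear_lipschitz (diff_continuous dh).
suff H e : 0 < e -> `|'D_u h w| <= e.
  apply/eqP; rewrite -normr_le0; apply/ler_addgt0Pl => e e0.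
  by rewrite addr0 H.
(* The distance from [y] to the line costs [M * e2 = e / 2], and the expansion error costs
   [e1 * N = e / 2], both relative to [t]. *)
move=> e0; pose e2 := e / 2 / M; have e20 : 0 < e2 by rewrite !divr_gt0.
pose N := `|u| + e2; have N0 : 0 < N by rewrite ltr_wpDl.
pose e1 := e / 2 / N; have e10 : 0 < e1 by rewrite !divr_gt0.
have [d d0 Hd] := tangent_to_common_zeros sF sG Fw Gw Fa Ga Fb Gb Fu Gu e20.
have /nbhs_ballP[d1 /= d10 Hd1] := differentiable_expansion dh e10.
have /nbhs_ballP[d2 /= d20 Hd2] := h0.
pose t := Num.min (d / 2) (Num.min d1 d2 / (2 * N)).
have t0 : 0 < t by rewrite !lt_min !divr_gt0 ?mulr_gt0 ?lt_min ?d10.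
have td : t < d by rewrite gt_min ltr_pdivrMr// ltr_pMr// ltrDl ltr01.
have tN : t * N < Num.min d1 d2.
  rewrite -ltr_pdivlMr// gt_min; apply/orP; right.
  by rewrite ltr_pM2l ?lt_min ?d10// ltf_pV2 ?posrE ?mulr_gt0// ltr_pMl// ltrDl.
have [|y [Fy Gy yt]] := Hd t; first by rewrite t0.
have kN : `|y - w| <= t * N.
  have -> : y - w = t *: u - (w + t *: u - y).
    by rewrite opprB addrCA [w + _]addrC opprD [_ *: _ + _]addrA subrr add0r.
  rewrite (le_trans (ler_normB _ _))// normrZ gtr0_norm// mulrDr lerD2l.
  by rewrite mulrC.
have hy : h y = 0.
  apply: Hd2 => //; rewrite -ball_normE /= distrC (le_lt_trans kN)//.
  by rewrite (lt_le_trans tN)// ge_min lexx orbT.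
have /Hd1 : ball (0 : 'rV[R]_n) d1 (y - w).
  rewrite -ball_normE /= sub0r normrN (le_lt_trans kN)//.
  by rewrite (lt_le_trans tN)// ge_min lexx.
rewrite /= subrKC hy hw subrr sub0r normrN => Hk.
rewrite -(@ler_pM2l _ t)// -{1}(gtr0_norm t0) -normrM.
have -> : t * 'D_u h w = 'D_(y - w) h w + 'd h w (w + t *: u - y).
  have yu : t *: u = y - w + (w + t *: u - y).
    by rewrite addrC addrA subrK addrAC subrr add0r.
  by rewrite !deriveE// -[LHS]linearZ /= {1}yu linearD.
rewrite (le_trans (ler_normD _ _))//.
rewrite (@le_trans _ _ (e1 * (t * N) + M * (e2 * t)))//.
  rewrite lerD// ?(le_trans Hk)// ?ler_wpM2l ?(ltW e10)//.
  by rewrite (le_trans (HM _))// ler_wpM2l ?(ltW M0).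
have -> : t * e = e1 * (t * N) + M * (e2 * t); last by [].
by rewrite /e1 /e2; field; rewrite !gt_eqF.
Qed.

(* The second difference is symmetric in [u] and [v], whence Schwarz's theorem. *)
Lemma second_difference (R : realType) (V : normedModType R) (f : V -> R)
    (w u v : V) :
  (\forall y \near w, differentiable f y) -> differentiable ('D_u f) w ->
  forall e, 0 < e -> exists2 d, 0 < d & forall t, 0 < t < d ->
    `|f (w + t *: u + t *: v) - f (w + t *: u) - f (w + t *: v) + f w
      - t ^+ 2 * 'D_v ('D_u f) w| <= e * t ^+ 2.
Proof.
move=> df du e e0.
have alg1 (s A B x D1 D0 D : R) : s * D = D1 - D0 ->
  s * (A - B) - s ^+ 2 * D = s * ((A - x - D1) - (B - x - D0)).
  by move=> sD; rewrite expr2 -mulrA sD; ring.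
have alg2 (p q : R) : p + q + p <= p + p + q + 1 by lra.
have alg3 (p q : R) : 0 <= p -> p + q <= p + p + q + 1 by lra.
(* [t * N] will dominate the sum of the norms of the two increments [k1] and [k0]; the final 1
   ensures positivity. *)
pose N := `|u| + `|u| + `|v| + 1; have N0 : 0 < N by rewrite ltr_wpDl ?addr_ge0.
have eN0 : 0 < e / N by rewrite divr_gt0.
have /nbhs_ballP[d1 /= d10 Hd1] := differentiable_expansion du eN0.
have /nbhs_ballP[d2 /= d20 Hd2] := df.
pose d := Num.min d1 d2; have d0 : 0 < d by rewrite lt_min d10.
exists (d / N); first by rewrite divr_gt0.
move=> t /andP[t0]; rewrite ltr_pdivlMr// => tN.
have small (c s : R) : 0 <= c <= 1 -> 0 <= s <= 1 ->
    `|c *: (t *: u) + s *: (t *: v)| <= t * (`|u| + `|v|).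
  move=> /andP[c0 c1] /andP[s0 s1].
  rewrite (le_trans (ler_normD _ _))// !normrZ (gtr0_norm t0) mulrDr.
  by rewrite !ger0_norm// lerD// ler_piMl// mulr_ge0// ltW.
have small' (c s : R) : 0 <= c <= 1 -> 0 <= s <= 1 ->
    `|c *: (t *: u) + s *: (t *: v)| < d.
  move=> c01 s01; rewrite (le_lt_trans (small _ _ c01 s01))//.
  by rewrite (le_lt_trans _ tN)// ler_wpM2l ?(ltW t0)// alg3.
have dfs (c s : R) : 0 <= c <= 1 -> 0 <= s <= 1 ->
    differentiable f (w + (c *: (t *: u) + s *: (t *: v))).
  move=> c01 s01; apply: Hd2; rewrite -ball_normE /= opprD addrA subrr sub0r.
  by rewrite normrN (lt_le_trans (small' _ _ c01 s01))// ge_min lexx orbT.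
have I0 : 0 <= (0 : R) <= 1 by rewrite lexx ler01.
have I1 : 0 <= (1 : R) <= 1 by rewrite lexx ler01.
(* The second difference is the increment of [g] along [t *: u]. The mean value theorem turns it
   into [t] times a difference of values of ['D_u f] at two points that differ by [t *: v]. *)
pose g y := f (y + t *: v) - f y.
have dg (c : R) : 0 <= c <= 1 -> is_diff (w + c *: (t *: u)) g
    ('d f (w + c *: (t *: u) + t *: v) \- 'd f (w + c *: (t *: u))).
  move=> c01.
  have := dfs _ _ c01 I1; rewrite scale1r addrA => dfc.
  have := dfs _ _ c01 I0; rewrite scale0r addr0 => dfc0.
  apply: is_diffB; last exact: differentiableP.
  have ds : is_diff (w + c *: (t *: u)) (fun y : V => y + t *: v) id.
    have -> : (fun y : V => y + t *: v) = id + cst (t *: v) by [].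
    by rewrite -[X in is_diff _ _ X](addr0 id); exact: is_diffD.
  exact: (is_diff_comp ds (differentiableP dfc)).
have [|c c01] := @mean_value_segment R V g w (t *: u).
  by move=> c /dg dgc; exact: ex_diff.
have {}c01 : 0 <= c <= 1 by case/andP: c01 => ? ?; rewrite !ltW.
pose k1 := c *: (t *: u) + 1 *: (t *: v).
pose k0 := c *: (t *: u) + 0 *: (t *: v).
have k1d := small' _ _ c01 I1; have k0d := small' _ _ c01 I0.
have /Hd1 /= H1 : ball (0 : V) d1 k1.
  by rewrite -ball_normE /= sub0r normrN (lt_le_trans k1d)// ge_min lexx.
have /Hd1 /= H0 : ball (0 : V) d1 k0.
  by rewrite -ball_normE /= sub0r normrN (lt_le_trans k0d)// ge_min lexx.
have dgc := dg c c01.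
have -> : 'D_(t *: u) g (w + c *: (t *: u)) =
    t * ('D_u f (w + k1) - 'D_u f (w + k0)).
  rewrite deriveE; last exact: ex_diff.
  rewrite diff_val /= /k1 /k0 scale1r scale0r addr0 addrA.
  have := dfs _ _ c01 I1; rewrite scale1r addrA => dfc.
  have := dfs _ _ c01 I0; rewrite scale0r addr0 => dfc0.
  have lin (x : V) : differentiable f x -> 'd f x (t *: u) = t * 'D_u f x.
    by move=> dfx; rewrite deriveE// linearZ.
  by rewrite !lin// mulrBr.
move=> gE.
have -> : f (w + t *: u + t *: v) - f (w + t *: u) - f (w + t *: v) + f w =
    t * ('D_u f (w + k1) - 'D_u f (w + k0)).
  by rewrite -gE /g; ring.
have Dk : t * 'D_v ('D_u f) w = 'D_k1 ('D_u f) w - 'D_k0 ('D_u f) w.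
  rewrite !deriveE// -linearB /k1 /k0 scale1r scale0r addr0 addrAC subrr add0r.
  by rewrite linearZ.
set A := 'D_u f (w + k1) in H1 *; set B := 'D_u f (w + k0) in H0 *.
have -> : t * (A - B) - t ^+ 2 * 'D_v ('D_u f) w =
    t * ((A - 'D_u f w - 'D_k1 ('D_u f) w) - (B - 'D_u f w - 'D_k0 ('D_u f) w)).
  exact: alg1.
rewrite normrM gtr0_norm// expr2 mulrCA ler_pM2l//.
rewrite (le_trans (ler_normB _ _))//.
rewrite (@le_trans _ _ (e / N * `|k1| + e / N * `|k0|)) ?lerD// -mulrDr.
have k1N := small _ _ c01 I1.
have k0N : `|k0| <= t * `|u|.
  have /andP[c0 c1] := c01.
  rewrite /k0 scale0r addr0 !normrZ (gtr0_norm t0) (ger0_norm c0).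
  by rewrite ler_piMl ?mulr_ge0 ?(ltW t0).
have -> : e * t = e / N * (t * N) by field; rewrite gt_eqF.
rewrite ler_pM2l//; apply: (le_trans (lerD k1N k0N)).
by rewrite -mulrDr ler_pM2l.
Qed.

(** Exchanging [u] and [v] leaves the second difference unchanged, while its quotient by [t ^+ 2]
    approximates either mixed derivative. *)
Lemma derive_comm (R : realType) (V : normedModType R) (f : V -> R)
    (w u v : V) :
  (\forall y \near w, differentiable f y) ->
  differentiable ('D_u f) w -> differentiable ('D_v f) w ->
  'D_v ('D_u f) w = 'D_u ('D_v f) w.
Proof.
move=> df du dv.
have alg (e s S p q r D1 D2 : R) : 0 < s ->
    `|S - p - q + r - s ^+ 2 * D1| <= e / 2 * s ^+ 2 ->
    `|S - q - p + r - s ^+ 2 * D2| <= e / 2 * s ^+ 2 -> `|D1 - D2| <= e.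
  move=> s0 h1 h2; rewrite -(@ler_pM2l _ (s ^+ 2)) ?exprn_gt0//.
  rewrite -{1}(@ger0_norm _ (s ^+ 2)) ?sqr_ge0// -normrM.
  have -> : s ^+ 2 * (D1 - D2) =
    (S - q - p + r - s ^+ 2 * D2) - (S - p - q + r - s ^+ 2 * D1) by ring.
  have -> : s ^+ 2 * e = e / 2 * s ^+ 2 + e / 2 * s ^+ 2 by lra.
  by rewrite (le_trans (ler_normB _ _))// lerD.
apply/eqP; rewrite -subr_eq0 -normr_le0.
apply/ler_addgt0Pl => e e0; rewrite addr0.
have e20 : 0 < e / 2 by rewrite divr_gt0.
have [d1 d10 H1] := second_difference v df du e20.
have [d2 d20 H2] := second_difference u df dv e20.
pose t := Num.min d1 d2 / 2.
have m0 : 0 < Num.min d1 d2 by rewrite lt_min d10.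
have t0 : 0 < t by rewrite divr_gt0.
have tm : t < Num.min d1 d2 by rewrite ltr_pdivrMr// ltr_pMr// ltrDl.
have /H1 {}H1 : 0 < t < d1 by rewrite t0 (lt_le_trans tm)// ge_min lexx.
have /H2 {}H2 : 0 < t < d2 by rewrite t0 (lt_le_trans tm)// ge_min lexx orbT.
rewrite (addrAC w) in H2.
exact: (alg _ _ _ _ _ _ _ _ t0 H1 H2).
Qed.

(** * Matrices and forms with differentiable entries *)

Section differentiable_matrices.
Variables (R : realType) (V : normedModType R) (w : V).

Lemma differentiable_bigsum (I : Type) (r : seq I) (P : pred I)
    (f : I -> V -> R) : (forall i, differentiable (f i) w) ->
  differentiable (fun y => \sum_(i <- r | P i) f i y) w.
Proof.
move=> df; elim: r => [|i r IH].
  rewrite [X in differentiable X _](_ : _ = cst 0).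
    exact: differentiable_cst.
  by apply/funext => y; rewrite big_nil.
under eq_fun => y do rewrite big_cons.
case: (P i) => //; exact: (differentiableD (df i) IH).
Qed.

Lemma differentiable_bigprod (I : Type) (r : seq I) (P : pred I)
    (f : I -> V -> R) : (forall i, differentiable (f i) w) ->
  differentiable (fun y => \prod_(i <- r | P i) f i y) w.
Proof.
move=> df; elim: r => [|i r IH].
  rewrite [X in differentiable X _](_ : _ = cst 1).
    exact: differentiable_cst.
  by apply/funext => y; rewrite big_nil.
under eq_fun => y do rewrite big_cons.
case: (P i) => //; exact: (differentiableM (df i) IH).
Qed.

(** Stated entrywise, so that determinants and adjugates reduce to sums and products of real
    functions. *)
Definition mx_differentiable m n (A : V -> 'M[R]_(m, n)) :=
  forall i j, differentiable (fun y => A y i j) w.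

Lemma mx_differentiable_cst m n (A : 'M[R]_(m, n)) :
  mx_differentiable (fun=> A).
Proof. by move=> i j; exact: differentiable_cst. Qed.

Lemma mx_differentiable_mul m n p (A : V -> 'M[R]_(m, n))
    (B : V -> 'M[R]_(n, p)) : mx_differentiable A -> mx_differentiable B ->
  mx_differentiable (fun y => A y *m B y).
Proof.
move=> dA dB i j; under eq_fun => y do rewrite mxE.
apply: differentiable_bigsum => k.
exact: (differentiableM (dA i k) (dB k j)).
Qed.

Lemma mx_differentiable_sub m n (A B : V -> 'M[R]_(m, n)) :
  mx_differentiable A -> mx_differentiable B ->
  mx_differentiable (fun y => A y - B y).
Proof.
move=> dA dB i j; under eq_fun => y do rewrite !mxE.
exact: (differentiableB (dA i j) (dB i j)).
Qed.

Lemma differentiable_det n (A : V -> 'M[R]_n) :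
  mx_differentiable A -> differentiable (fun y => \det (A y)) w.
Proof.
move=> dA; rewrite /determinant; apply: differentiable_bigsum => s.
have dp : differentiable (fun y => \prod_i A y i (s i)) w.
  by apply: differentiable_bigprod => i; exact: dA.
exact: (differentiableM (differentiable_cst ((-1) ^+ s : R) w) dp).
Qed.

Lemma mx_differentiable_adj n (A : V -> 'M[R]_n) :
  mx_differentiable A -> mx_differentiable (fun y => \adj (A y)).
Proof.
move=> dA i j; under eq_fun => y do rewrite mxE /cofactor.
have dd : differentiable (fun y => \det (row' j (col' i (A y)))) w.
  by apply: differentiable_det => k l; under eq_fun => y do rewrite !mxE.
exact: (differentiableM (differentiable_cst ((-1) ^+ (j + i) : R) w) dd).
Qed.

Lemma mx_differentiable_scalar n (f : V -> R) :
  differentiable f w -> mx_differentiable (fun y => (f y)%:M : 'M[R]_n).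
Proof.
move=> df i j; under eq_fun => y do rewrite mxE.
case: (i == j); first by [].
exact: (differentiable_cst (0 : R)).
Qed.

End differentiable_matrices.

(** * The pairing of covectors with vectors *)

Section forms.
Variable R : realType.
Implicit Types (a : covector R) (u v : J2 R).

Lemma evE a v : ev a v = \sum_i v 0 i * a i 0. Proof. by rewrite /ev mxE. Qed.

Lemma evDr a u v : ev a (u + v) = ev a u + ev a v.
Proof. by rewrite /ev mulmxDl mxE. Qed.

Lemma evNr a v : ev a (- v) = - ev a v.
Proof. by rewrite /ev mulNmx mxE. Qed.

Lemma evZr a c v : ev a (c *: v) = c * ev a v.
Proof. by rewrite /ev -scalemxAl mxE. Qed.

Lemma evBl a b u : ev (a - b) u = ev a u - ev b u.
Proof. by rewrite /ev mulmxBr !mxE. Qed.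

Lemma evZl a c u : ev (c *: a) u = c * ev a u.
Proof. by rewrite /ev -scalemxAr mxE. Qed.

Lemma mem_annihilated a v : (v \in annihilated a) = (ev a v == 0).
Proof.
rewrite /annihilated memv_ker lfunE /= /ev; apply/eqP/eqP => [-> |h].
  by rewrite mxE.
by apply/matrixP => i j; rewrite !ord1 h mxE.
Qed.

Lemma ev_differential (F : J2 R -> R) w v :
  differentiable F w -> ev (differential F w) v = 'D_v F w.
Proof.
move=> dF; rewrite evE derive_row_sum_delta//.
by apply: eq_bigr => i _; rewrite mxE.
Qed.

(** The Leibniz rule, with the second term freezing the field at [Y w]: this is the shape of the
    terms of [ext_d], which uses constant fields. *)
Lemma derive_ev (a : one_form R) (Y : J2 R -> J2 R) (w u : J2 R) :
  (forall i, differentiable (fun y => a y i 0) w) ->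
  (forall i, differentiable (fun y => Y y 0 i) w) ->
  'D_u (fun y => ev (a y) (Y y)) w =
    ev (a w) (\row_i 'D_u (fun y => Y y 0 i) w) +
    'D_u (fun y => ev (a y) (Y w)) w.
Proof.
move=> da dY.
have E (Z : J2 R -> J2 R) : (forall i, differentiable (fun y => Z y 0 i) w) ->
    'D_u (fun y => ev (a y) (Z y)) w =
      \sum_i (Z w 0 i * 'D_u (fun y => a y i 0) w +
      a w i 0 * 'D_u (fun y => Z y 0 i) w).
  move=> dZ.
  have -> : (fun y => ev (a y) (Z y)) =
      \sum_i ((fun y => Z y 0 i) * (fun y => a y i 0)).
    by apply/funext => y; rewrite evE fct_sumE.
  rewrite derive_sum => [|i]; last by apply/diff_derivable/differentiableM.
  by apply: eq_bigr => i _; rewrite deriveM//; exact/diff_derivable.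
rewrite (E Y dY) (E (fun=> Y w)); last by move=> i; exact: differentiable_cst.
rewrite evE -big_split; apply: eq_bigr => i _ /=.
by rewrite mxE derive_cst mulr0 addr0 addrC [a w i 0 * _]mulrC.
Qed.

End forms.

(** * The bracket of two sections of [D] *)

Section bracket.
Variables (R : realType) (F G : J2 R -> R).
Hypothesis FGreg : regular_system F G.

(** The columns are the five covectors that cut out [Dspace F G y], which is thus the left kernel of
    this matrix. *)
Definition Dforms (y : J2 R) : 'M[R]_(8, 5) := \matrix_(i, j)
  nth 0 [:: differential F y; differential G y; contact0 y; contact1 y;
    contact2 y] j i 0.

Lemma mem_cap_annihilated2 (a b : covector R) v :
  (v \in (annihilated a :&: annihilated b)%VS) = (ev a v == 0) && (ev b v == 0).
Proof. by rewrite memv_cap 2!mem_annihilated. Qed.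

Lemma mem_tangent y v : (v \in tangent F G y) =
  (ev (differential F y) v == 0) && (ev (differential G y) v == 0).
Proof. exact: mem_cap_annihilated2. Qed.

Lemma mem_cap_annihilated3 (U : {vspace J2 R}) (a b c : covector R) v :
  (v \in (U :&: (annihilated a :&: (annihilated b :&: annihilated c)))%VS) =
  [&& v \in U, ev a v == 0, ev b v == 0 & ev c v == 0].
Proof. by rewrite 3!memv_cap 3!mem_annihilated. Qed.

Lemma mem_Dspace_tangent y v : v \in Dspace F G y -> v \in tangent F G y.
Proof. by rewrite mem_cap_annihilated3 => /andP[]. Qed.

Lemma mem_Dspace y v : (v \in Dspace F G y) = (v *m Dforms y == 0).
Proof.
have D (j : 'I_5) : (v *m Dforms y) 0 j = ev (nth 0 [:: differential F y;
    differential G y; contact0 y; contact1 y; contact2 y] j) v.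
  by rewrite evE mxE; apply: eq_bigr => i _; rewrite mxE.
rewrite mem_cap_annihilated3 mem_tangent.
apply/idP/eqP => [|h].
  move=> /andP[/andP[/eqP F0 /eqP G0] /and3P[/eqP h0 /eqP h1 /eqP h2]].
  apply/rowP => j; rewrite D mxE.
  by case: j => -[|[|[|[|[|j]]]]] j5; [exact: F0|exact: G0|exact: h0|exact: h1|
    exact: h2|].
have H (j : 'I_5) : ev (nth 0 [:: differential F y; differential G y;
    contact0 y; contact1 y; contact2 y] j) v == 0 :> R by rewrite -D h mxE.
by rewrite (H 0) (H 1) (H 2) (H 3) (H 4).
Qed.

(** The five columns are independent. The contact forms have no [r], [s], [t] components, so
    regularity kills the coefficients of the differentials of [F] and [G]; the [z], [p], [q]
    components then kill the other three. *)
Lemma Dforms_left_inverse w : locus F G w -> exists C, C *m Dforms w = 1%:M.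
Proof.
have [_ _ _ /[apply] fr] := FGreg.
apply/row_fullP; rewrite /row_full -mxrank_tr -[_ == _]/(row_free _).
apply: inj_row_free => c.
move=> /rowP cM.
have {}cM i : c 0 0 * partial i F w + c 0 1 * partial i G w +
    c 0 2 * contact0 w i 0 + c 0 3 * contact1 w i 0 +
    c 0 4 * contact2 w i 0 = 0.
  have := cM i; rewrite !mxE => <-.
  rewrite !big_ord_recr big_ord0 /= !mxE /= add0r.
  by congr (c 0 _ * _ + c 0 _ * _ + c 0 _ * _ + c 0 _ * _ + c 0 _ * _);
    exact/val_inj.
have vertical (i : 'I_8) : (5 <= i)%N ->
    c 0 0 * partial i F w + c 0 1 * partial i G w = 0.
  have := cM i; rewrite !mxE; case: i => -[|[|[|[|[|i]]]]]// ? + _.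
  by rewrite /= !(mulr0, subr0, addr0).
pose k (i : 'I_2) := c 0 (widen_ord (isT : (2 <= 5)%N) i).
have k0 : forall i, k i = 0.
  apply: (freeP (X := [tuple fibre_gradient F w; fibre_gradient G w]) fr).
  rewrite !big_ord_recr big_ord0 /= add0r; apply/rowP => j; rewrite !mxE.
  rewrite -[RHS](vertical (tnth [tuple ir; is_; it] j)).
    by congr (c 0 _ * _ + c 0 _ * _); exact/val_inj.
  by case: j => -[|[|[|]]].
have c0 : c 0 0 = 0 by rewrite -(k0 0); congr (c 0 _); exact/val_inj.
have c1 : c 0 1 = 0 by rewrite -(k0 1); congr (c 0 _); exact/val_inj.
have simp := (oppr0, mulr0, subr0, addr0, add0r, mul0r, mulr1).
have c2 : c 0 2 = 0 by have := cM iz; rewrite c0 c1 !mxE /= !simp.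
have c3 : c 0 3 = 0 by have := cM ip; rewrite c0 c1 !mxE /= !simp.
have c4 : c 0 4 = 0 by have := cM iq; rewrite c0 c1 !mxE /= !simp.
apply/rowP => j; rewrite mxE.
have [->|[->|[->|[->|->]]]] // : j = 0 \/ j = 1 \/ j = 2 \/ j = 3 \/ j = 4.
case: j => -[|[|[|[|[|]]]]]// ?; [left|right; left|right; right; left|
  right; right; right; left|right; right; right; right]; exact/val_inj.
Qed.

Lemma differentiable_F y : differentiable F y.
Proof. by have [/(_ [::] y I)] := FGreg. Qed.

Lemma differentiable_G y : differentiable G y.
Proof. by have [_ /(_ [::] y I)] := FGreg. Qed.

Lemma differentiable_partial_F i y : differentiable (partial i F) y.
Proof. by have [/(_ [:: i] y I)] := FGreg. Qed.

Lemma differentiable_partial_G i y : differentiable (partial i G) y.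
Proof. by have [_ /(_ [:: i] y I)] := FGreg. Qed.

(** The first two rows of a left inverse of [Dforms w] are dual to the differentials of [F] and [G],
    and serve as the vectors [a] and [b] of Lyusternik's theorem. *)
Lemma derive_zero_on_locus w u (h : J2 R -> R) :
  locus F G w -> u \in tangent F G w -> differentiable h w ->
  (\forall y \near w, locus F G y -> h y = 0) -> 'D_u h w = 0.
Proof.
move=> Lw; rewrite mem_tangent => /andP[/eqP uF /eqP uG] dh h0.
have [C CM] := Dforms_left_inverse Lw.
have rowC i (j : 'I_5) : ev (nth 0 [:: differential F w; differential G w;
    contact0 w; contact1 w; contact2 w] j) (row i C) = (i == j)%:R :> R.
  have := congr1 (fun A : 'M_5 => A i j) CM; rewrite !mxE => <-.
  by rewrite evE; apply: eq_bigr => k _; rewrite !mxE.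
have dF := differentiable_F w; have dG := differentiable_G w.
have sF : strict_derivative F w ('d F w).
  apply: strict_derivative_rV => [|i].
    by apply: (@nearW _ (nbhs w)) => y; exact: differentiable_F.
  exact: (differentiable_continuous (differentiable_partial_F i w)).
have sG : strict_derivative G w ('d G w).
  apply: strict_derivative_rV => [|i].
    by apply: (@nearW _ (nbhs w)) => y; exact: differentiable_G.
  exact: (differentiable_continuous (differentiable_partial_G i w)).
have eF v : 'd F w v = ev (differential F w) v.
  exact: (etrans (esym (deriveE v dF)) (esym (ev_differential v dF))).
have eG v : 'd G w v = ev (differential G w) v.
  exact: (etrans (esym (deriveE v dG)) (esym (ev_differential v dG))).
have [Fw Gw] := Lw.
apply: (derive_zero_on_common_zeros sF sG Fw Gw (etrans (eF _) (rowC 0 0))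
  (etrans (eG _) (rowC 0 1)) (etrans (eF _) (rowC 1 0))
  (etrans (eG _) (rowC 1 1)) (etrans (eF _) uF) (etrans (eG _) uG) dh).
by apply: filterS h0 => y H Fy Gy; exact: H.
Qed.

Lemma differentiable_contact (j : 'I_3) w i : differentiable (fun y =>
  nth 0 [:: contact0 y; contact1 y; contact2 y] j i 0 : R) w.
Proof.
have dc k l (a b c : R) : differentiable (fun y : J2 R =>
    a - y 0 k * b - y 0 l * c) w.
  have dk (m : 'I_8) (e : R) : differentiable (fun y : J2 R => y 0 m * e) w.
    exact: (differentiableM (differentiable_coord _ _ _)
      (differentiable_cst e w)).
  exact: (differentiableB (differentiableB (differentiable_cst a w) (dk k b))
    (dk l c)).
by case: j => -[|[|[|]]]//= ?; under eq_fun => y do rewrite !mxE; exact: dc.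
Qed.

Lemma mx_differentiable_Dforms w : mx_differentiable w Dforms.
Proof.
move=> i j; under eq_fun => y do rewrite mxE.
case: j => -[|[|[|[|[|]]]]]//= ?.
- under eq_fun => y do rewrite mxE; exact: differentiable_partial_F.
- under eq_fun => y do rewrite mxE; exact: differentiable_partial_G.
- exact: (@differentiable_contact 0).
- exact: (@differentiable_contact 1).
- exact: (@differentiable_contact 2).
Qed.

Lemma differentiable_derive_dir (H : J2 R -> R) w v :
  (forall y, differentiable H y) ->
  (forall i y, differentiable (partial i H) y) -> differentiable ('D_v H) w.
Proof.
move=> dH dpH; rewrite (_ : 'D_v H = fun y => \sum_i v 0 i * partial i H y).
  apply: differentiable_bigsum => i.
  exact: (differentiableM (differentiable_cst (v 0 i) w) (dpH i w)).
by apply/funext => y; rewrite derive_row_sum_delta.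
Qed.

(** An exact form is closed, by the symmetry of second derivatives. *)
Lemma ext_d_differential (H : J2 R -> R) w u v :
  (forall y, differentiable H y) ->
  (forall i y, differentiable (partial i H) y) ->
  ext_d (differential H) w u v = 0.
Proof.
move=> dH dpH.
have E z : (fun y => ev (differential H y) z) = 'D_z H.
  by apply/funext => y; rewrite ev_differential.
rewrite /ext_d !E (derive_comm (u := v) (v := u)) ?subrr//.
- by apply: (@nearW _ (nbhs w)).
- exact: differentiable_derive_dir.
- exact: differentiable_derive_dir.
Qed.

(* With [M = Dforms] and [C] a left inverse of [M w], take
   [P = det (C M) - M adj (C M) C], so that [P M = 0] and [P w = 1 - M w C]. *)
Lemma Dspace_projections w : locus F G w ->
  exists P : J2 R -> 'M[R]_8, [/\ mx_differentiable w P,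
    forall x y, x *m P y \in Dspace F G y &
    forall x, x \in Dspace F G w -> x *m P w = x].
Proof.
move=> Lw; have [C CM] := Dforms_left_inverse Lw.
pose P y : 'M[R]_8 :=
  (\det (C *m Dforms y))%:M - Dforms y *m \adj (C *m Dforms y) *m C.
have dP : mx_differentiable w P.
  have dM := mx_differentiable_Dforms w.
  have dA := mx_differentiable_mul (mx_differentiable_cst w C) dM.
  apply: mx_differentiable_sub.
    exact/mx_differentiable_scalar/differentiable_det.
  apply: mx_differentiable_mul; last exact: mx_differentiable_cst.
  by apply: mx_differentiable_mul => //; exact: mx_differentiable_adj.
have PD x y : x *m P y \in Dspace F G y.
  rewrite mem_Dspace -mulmxA /P mulmxBl -!mulmxA mul_adj_mx.
  by rewrite mul_scalar_mx mul_mx_scalar subrr mulmx0.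
have Pw x : x \in Dspace F G w -> x *m P w = x.
  rewrite mem_Dspace => /eqP xM.
  by rewrite /P CM det1 mulmxBr mulmx1 !mulmxA xM !mul0mx subr0.
by exists P.
Qed.

(* The vector fields [y |-> u *m P y] and [y |-> v *m P y] take values in [D]
   along the locus, and [B] is their bracket at [w]. *)
Lemma ext_d_bracket w u v : locus F G w ->
  u \in Dspace F G w -> v \in Dspace F G w ->
  exists2 B : J2 R, B \in tangent F G w &
  forall a : one_form R, (forall i, differentiable (fun y => a y i 0) w) ->
    (\forall y \near w, locus F G y ->
      forall x, x \in Dspace F G y -> ev (a y) x = 0) ->
    ext_d a w u v = - ev (a w) B.
Proof.
move=> Lw uD vD; have [P [dP PD Pw]] := Dspace_projections Lw.
have dX (x : J2 R) i : differentiable (fun y => (x *m P y) 0 i) w.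
  exact: (mx_differentiable_mul (mx_differentiable_cst w x) dP).
pose W (x z : J2 R) : J2 R := \row_i 'D_x (fun y => (z *m P y) 0 i) w.
(* The function [ev (a y) (z *m P y)] vanishes on the locus, so its derivative along [x] is zero;
   the Leibniz rule moves the derivative from [a] to the field. *)
have key x z (a : one_form R) : x \in Dspace F G w -> z \in Dspace F G w ->
    (forall i, differentiable (fun y => a y i 0) w) ->
    (\forall y \near w, locus F G y ->
      forall x, x \in Dspace F G y -> ev (a y) x = 0) ->
    'D_x (fun y => ev (a y) z) w = - ev (a w) (W x z).
  move=> xD zD da a0.
  have : 'D_x (fun y => ev (a y) (z *m P y)) w = 0.
    apply: (derive_zero_on_locus Lw (mem_Dspace_tangent xD)).
      under eq_fun => y do rewrite evE.
      apply: differentiable_bigsum => i.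
      exact: (differentiableM (dX z i) (da i)).
    by apply: filterS a0 => y H Ly; exact: (H Ly).
  rewrite (derive_ev x da (dX z)) (Pw z zD) => /eqP.
  rewrite addr_eq0 => /eqP ->.
  by rewrite opprK.
have main (a : one_form R) : (forall i, differentiable (fun y => a y i 0) w) ->
    (\forall y \near w, locus F G y ->
      forall x, x \in Dspace F G y -> ev (a y) x = 0) ->
    ext_d a w u v = - ev (a w) (W u v - W v u).
  move=> da a0; rewrite /ext_d (key u v a uD vD da a0) (key v u a vD uD da a0).
  by rewrite evDr evNr opprD.
exists (W u v - W v u) => //.
(* Tangency of the bracket: the formula just proved applies to the differentials of [F] and [G],
   which vanish on [D] and are closed. *)
have dFw i : differentiable (fun y => differential F y i 0) w.
  under eq_fun => y do rewrite mxE; exact: differentiable_partial_F.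
have dGw i : differentiable (fun y => differential G y i 0) w.
  under eq_fun => y do rewrite mxE; exact: differentiable_partial_G.
have dF0 : \forall y \near w, locus F G y ->
    forall x, x \in Dspace F G y -> ev (differential F y) x = 0.
  apply: (@nearW _ (nbhs w)) => y _ x /mem_Dspace_tangent.
  by rewrite mem_tangent => /andP[/eqP].
have dG0 : \forall y \near w, locus F G y ->
    forall x, x \in Dspace F G y -> ev (differential G y) x = 0.
  apply: (@nearW _ (nbhs w)) => y _ x /mem_Dspace_tangent.
  by rewrite mem_tangent => /andP[_ /eqP].
rewrite mem_tangent -(oppr_eq0 (ev (differential F w) _)).
rewrite -(oppr_eq0 (ev (differential G w) _)).
rewrite -(main _ dFw dF0) -(main _ dGw dG0).
rewrite (ext_d_differential w u v differentiable_F differentiable_partial_F).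
rewrite (ext_d_differential w u v differentiable_G differentiable_partial_G).
by rewrite eqxx.
Qed.
End bracket.

(** * Vertical vectors *)

Section vertical.
Variable R : realType.

Lemma coord_derive (w u : J2 R) i : 'D_u (fun y : J2 R => y 0 i) w = u 0 i.
Proof.
have dc : derivable (id : J2 R -> J2 R) w u by exact: derivable_id.
have := derive_mx dc; rewrite derive_id => /matrixP/(_ 0 i).
by rewrite mxE => <-.
Qed.

Lemma diff_pi21 (w : J2 R) : 'd (@pi21 R) w = @pi21 R :> (J2 R -> J1 R).
Proof.
pose f (j : 'I_5) (y : J2 R) : J1 R :=
  y 0 (widen_ord (isT : (5 <= 8)%N) j) *: delta_mx 0 j.
have fE : @pi21 R = \sum_j f j.
  apply/funext => y; rewrite fct_sumE; apply/rowP => j.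
  rewrite [in LHS]mxE summxE (bigD1 j)//= big1 => [|k /negPf kj].
    by rewrite !mxE !eqxx mulr1 addr0.
  by rewrite !mxE eqxx eq_sym kj mulr0.
have df : differentiable (@pi21 R) w.
  rewrite fE; apply: differentiable_sum => j.
  exact: (differentiableZl (delta_mx 0 j) (differentiable_coord _ _ _)).
apply/funext => u; rewrite -(deriveE u df) (derive_mx (diff_derivable df)).
apply/rowP => j; rewrite !mxE.
under eq_fun => y do rewrite mxE.
exact: coord_derive.
Qed.

Lemma mem_ker_pi21 (F G : J2 R -> R) w u : (u \in ker_pi21 F G w) =
  (u \in tangent F G w) && (pi21 u == 0).
Proof. by rewrite /ker_pi21 memv_cap memv_ker lfunE /= diff_pi21. Qed.

Lemma pi21_eq0 (u : J2 R) : (pi21 u == 0) =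
  [&& u 0 ix == 0, u 0 iy == 0, u 0 iz == 0, u 0 ip == 0 & u 0 iq == 0].
Proof.
have E (j : 'I_5) : pi21 u 0 j = u 0 (widen_ord (isT : (5 <= 8)%N) j).
  by rewrite mxE.
have e (i : 'I_8) (j : 'I_5) : i = j :> nat -> u 0 i = pi21 u 0 j.
  by move=> ij; rewrite E; congr (u 0 _); exact: val_inj.
rewrite (e ix 0) // (e iy 1) // (e iz 2) // (e ip 3) // (e iq 4) //.
apply/eqP/and5P => [->|[/eqP h0 /eqP h1 /eqP h2 /eqP h3 /eqP h4]].
  by rewrite !mxE.
apply/rowP => j; rewrite [RHS]mxE.
by case: j => -[|[|[|[|[|j]]]]] j5 //; [rewrite -[RHS]h0|rewrite -[RHS]h1|
  rewrite -[RHS]h2|rewrite -[RHS]h3|rewrite -[RHS]h4]; congr (pi21 u 0 _);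
  exact: val_inj.
Qed.

(** Rank-nullity for a map into a one-dimensional space. *)
Lemma dim_cap_annihilated (U : {vspace J2 R}) (a : covector R) :
  (\dim U <= (\dim (U :&: annihilated a)%VS).+1)%N.
Proof.
rewrite -(limg_ker_dim (linfun (mulmxr a : J2 R -> 'M[R]_1)) U).
rewrite -[(\dim _).+1]addn1 leq_add2l.
by rewrite (leq_trans (dimvS (subvf _)))// dimvf.
Qed.

Lemma ev_dcoord i (u : J2 R) : ev (dcoord R i) u = u 0 i.
Proof.
rewrite evE (bigD1 i)//= big1 => [|k /negPf ki].
  by rewrite !mxE !eqxx mulr1 addr0.
rewrite !mxE.
by rewrite ki mulr0.
Qed.

Lemma ev_contact (w u : J2 R) : [/\
  ev (contact0 w) u = u 0 iz - w 0 ip * u 0 ix - w 0 iq * u 0 iy,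
  ev (contact1 w) u = u 0 ip - w 0 ir * u 0 ix - w 0 is_ * u 0 iy &
  ev (contact2 w) u = u 0 iq - w 0 is_ * u 0 ix - w 0 it * u 0 iy].
Proof.
have E i j k (b c : R) :
    ev (dcoord R i - b *: dcoord R j - c *: dcoord R k) u =
    u 0 i - b * u 0 j - c * u 0 k.
  by rewrite !evBl !evZl !ev_dcoord.
by split; exact: E.
Qed.

Lemma dim_tangent (F G : J2 R -> R) w : (6 <= \dim (tangent F G w))%N.
Proof.
have h1 := dim_cap_annihilated fullv (differential F w).
have h2 :=
  dim_cap_annihilated (annihilated (differential F w)) (differential G w).
move: h1; rewrite capfv dimvf => h1.
by rewrite -ltnS -[X in (X <= _)%N]/7%N; rewrite -ltnS (leq_trans h1).
Qed.

(** Five coordinate conditions imposed on a tangent space of dimension at least 6 leave a nonzero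
    vector. *)
Lemma ker_pi21_neq0 (F G : J2 R -> R) w :
  exists2 e, e \in ker_pi21 F G w & e != 0.
Proof.
pose U := tangent F G w.
pose cut := foldl (fun U i => (U :&: annihilated (dcoord R i))%VS) U.
have memcut s u : u \in cut s -> u \in U /\ forall i, i \in s -> u 0 i = 0.
  elim/last_ind: s => [|s i IH]; first by [].
  rewrite /cut foldl_rcons memv_cap mem_annihilated ev_dcoord.
  move=> /andP[/IH[uU us] /eqP ui]; split=> // j.
  by rewrite mem_rcons inE => /predU1P[->|/us].
have dimcut s : (\dim U <= \dim (cut s) + size s)%N.
  elim/last_ind: s => [|s i IH]; first by rewrite addn0.
  rewrite (leq_trans IH)// size_rcons addnS -addSn leq_add2r /cut foldl_rcons.
  exact: dim_cap_annihilated.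
have d0 : (0 < \dim (cut [:: ix; iy; iz; ip; iq]))%N.
  have := leq_trans (dim_tangent F G w) (dimcut [:: ix; iy; iz; ip; iq]).
  by rewrite -[6%N]/(1 + 5)%N leq_add2r.
exists (vpick (cut [:: ix; iy; iz; ip; iq])); last first.
  by rewrite vpick0 -dimv_eq0 -lt0n.
have [tU h] := memcut _ _ (memv_pick (cut [:: ix; iy; iz; ip; iq])).
rewrite mem_ker_pi21 tU pi21_eq0.
by rewrite !h ?eqxx.
Qed.

End vertical.

(** * Types and integral elements *)

Section types.
Variables (R : realType) (F G : J2 R -> R).
Hypothesis FGreg : regular_system F G.

(** The contact forms involve only the differentials of [x], [y], [z], [p], [q], which vanish on
    vertical vectors. *)
Lemma ker_pi21_Dspace w v : v \in ker_pi21 F G w -> v \in Dspace F G w.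
Proof.
rewrite mem_ker_pi21 pi21_eq0 => /andP[vT].
move=> /and5P[/eqP x0 /eqP y0 /eqP z0 /eqP p0 /eqP q0].
have [c0 c1 c2] := ev_contact w v.
rewrite mem_cap_annihilated3 vT c0 c1 c2 x0 y0 z0 p0 q0.
by rewrite !mulr0 !subr0 !eqxx.
Qed.

(** The differential is [dx ^ dp + dy ^ dq], and a vertical vector kills all four factors. *)
Lemma ext_d_contact0_vertical w e v : pi21 e = 0 ->
  ext_d (@contact0 R) w e v = 0.
Proof.
move/eqP; rewrite pi21_eq0 => /and5P[/eqP x0 /eqP y0 /eqP z0 /eqP p0 /eqP q0].
rewrite /ext_d.
have -> : (fun y => ev (contact0 y) e) = cst 0.
  apply/funext => y; have [-> _ _] := ev_contact y e.
  by rewrite x0 y0 z0 !mulr0 !subr0.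
rewrite derive_cst subr0.
have dc (i : 'I_8) : derivable (fun y : J2 R => y 0 i) w e.
  exact: (diff_derivable (differentiable_coord _ _ _)).
have -> : (fun y => ev (contact0 y) v) = cst (v 0 iz) -
    v 0 ix *: (fun y : J2 R => y 0 ip) - v 0 iy *: (fun y : J2 R => y 0 iq).
  apply/funext => y; have [-> _ _] := ev_contact y v.
  by rewrite !fctE [y 0 ip * _]mulrC [y 0 iq * _]mulrC.
have d1 := @derivableZ _ _ _ _ (v 0 ix) _ _ (dc ip).
have d2 := @derivableZ _ _ _ _ (v 0 iy) _ _ (dc iq).
have d0 := derivable_cst (v 0 iz) w e.
rewrite (deriveB (derivableB d0 d1) d2) (deriveB d0 d1).
rewrite (@deriveZ _ _ _ _ (v 0 ix) _ _ (dc ip)).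
rewrite (@deriveZ _ _ _ _ (v 0 iy) _ _ (dc iq)) derive_cst.
by rewrite !coord_derive p0 q0 !scaler0 !subr0.
Qed.

Lemma coframe_separates (T : {vspace J2 R}) (es : seq (covector R)) v :
  dual_basis_of T es -> v \in T ->
  (forall i, (i < size es)%N -> ev es`_i v = 0) -> v = 0.
Proof.
move=> dual vT es0; apply/rowP => i; rewrite mxE -ev_dcoord.
have [c [cE _]] := dual (dcoord R i).
by rewrite (cE v vT) big1 // => j _; rewrite es0 ?mulr0.
Qed.

Lemma coframe_free (T : {vspace J2 R}) (es : seq (covector R))
    (c : 'rV[R]_(size es)) :
  dual_basis_of T es ->
  (forall v, v \in T -> \sum_i c 0 i * ev es`_i v = 0) -> c = 0.
Proof.
move=> dual c0; have [d [dE dU]] := dual 0.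
have ev0 v : ev (0 : covector R) v = 0 by rewrite /ev mulmx0 mxE.
rewrite -(dU c) => [|v vT]; last by rewrite ev0 c0.
by apply: dU => v vT; rewrite ev0 big1// => i _; rewrite mxE mul0r.
Qed.

(** Both sides say that the bracket [B] lies in [Dspace F G w]: it is tangent and killed by
    [contact0 w], so either remaining pair of forms decides membership. *)
Lemma ext_d_transfer w (U : set (J2 R)) (w1 w2 : one_form R) u v :
  locus F G w -> open U -> U w -> smooth_form_on U w1 -> smooth_form_on U w2 ->
  (forall y, locus F G y -> U y -> Dspace F G y =
    (tangent F G y :&: (annihilated (contact0 y) :&:
      (annihilated (w1 y) :&: annihilated (w2 y))))%VS) ->
  u \in Dspace F G w -> v \in Dspace F G w -> ext_d (@contact0 R) w u v = 0 ->
  (ext_d (@contact1 R) w u v = 0 /\ ext_d (@contact2 R) w u v = 0) <->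
  (ext_d w1 w u v = 0 /\ ext_d w2 w u v = 0).
Proof.
move=> Lw oU Uw s1 s2 DE uD vD d0.
have nU : \forall y \near w, U y by exact: open_nbhs_nbhs.
have [B BT BE] := ext_d_bracket FGreg Lw uD vD.
have mD y x : x \in Dspace F G y -> [/\ ev (contact0 y) x = 0,
    ev (contact1 y) x = 0 & ev (contact2 y) x = 0].
  by rewrite mem_cap_annihilated3 => /and4P[_ /eqP ? /eqP ? /eqP ?].
have mE y x : locus F G y -> U y -> x \in Dspace F G y ->
    ev (w1 y) x = 0 /\ ev (w2 y) x = 0.
  move=> Ly Uy; rewrite (DE y Ly Uy) mem_cap_annihilated3.
  by move=> /and4P[_ _ /eqP ? /eqP ?].
have E0 : ext_d (@contact0 R) w u v = - ev (contact0 w) B.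
  apply: BE; first exact: (@differentiable_contact R 0).
  by apply: (@nearW _ (nbhs w)) => y _ x /mD[].
have E1 : ext_d (@contact1 R) w u v = - ev (contact1 w) B.
  apply: BE; first exact: (@differentiable_contact R 1).
  by apply: (@nearW _ (nbhs w)) => y _ x /mD[].
have E2 : ext_d (@contact2 R) w u v = - ev (contact2 w) B.
  apply: BE; first exact: (@differentiable_contact R 2).
  by apply: (@nearW _ (nbhs w)) => y _ x /mD[].
have F1 : ext_d w1 w u v = - ev (w1 w) B.
  apply: BE; first by move=> i; exact: (s1 i [::] w Uw).
  by apply: filterS nU => y Uy Ly x /(mE y x Ly Uy)[].
have F2 : ext_d w2 w u v = - ev (w2 w) B.
  apply: BE; first by move=> i; exact: (s2 i [::] w Uw).
  by apply: filterS nU => y Uy Ly x /(mE y x Ly Uy)[].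
have B0 : ev (contact0 w) B = 0 by apply/eqP; rewrite -oppr_eq0 -E0 d0.
rewrite E1 E2 F1 F2; split=> -[/eqP h1 /eqP h2]; rewrite !oppr_eq0 in h1 h2.
- have BD : B \in Dspace F G w by rewrite mem_cap_annihilated3 BT B0 h1 h2 eqxx.
  by have [-> ->] := mE w B Lw Uw BD; rewrite oppr0.
- have BD : B \in Dspace F G w.
    by rewrite (DE w Lw Uw) mem_cap_annihilated3 BT B0 h1 h2 eqxx.
  by have [_ -> ->] := mD w B BD; rewrite oppr0.
Qed.

Lemma wedge_eq0 (a b : covector R) u v :
  ev b u = 0 -> ev b v = 0 -> wedge a b u v = 0.
Proof. by rewrite /wedge => -> ->; rewrite !mulr0 subrr. Qed.

(** Extracts from the coframe what both cases use: coordinates on [D], two of which vanish on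
    vertical vectors, and a criterion for integral pairs in terms of these coordinates alone. *)
Lemma structure_equations k w : of_type F G k -> locus F G w ->
  exists o1 o2 pi : covector R, [/\
    forall x, x \in Dspace F G w ->
      ev o1 x = 0 -> ev o2 x = 0 -> ev pi x = 0 -> x = 0,
    forall x, x \in ker_pi21 F G w -> ev o1 x = 0 /\ ev o2 x = 0 &
    forall u v, u \in Dspace F G w -> v \in Dspace F G w ->
      ext_d (@contact0 R) w u v = 0 /\
      (ext_d (@contact1 R) w u v = 0 /\ ext_d (@contact2 R) w u v = 0 <->
       structure1 k o1 o2 pi u v = 0 /\ structure2 k o1 o2 pi u v = 0)].
Proof.
move=> ktype Lw; have [U [w1 [w2 [ o1 [ o2 [pi H] ] ] ] ] ] := ktype w Lw.
case: H => -[oU Uw] [s1 s2 _ _ _] dual DE [e0 e1 e2].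
have {}dual := dual w Lw Uw.
have DT x : x \in Dspace F G w -> x \in tangent F G w.
  exact: mem_Dspace_tangent.
have D0 x : x \in Dspace F G w ->
    [/\ ev (contact0 w) x = 0, ev (w1 w) x = 0 & ev (w2 w) x = 0].
  rewrite (DE w Lw Uw) mem_cap_annihilated3.
  by move=> /and4P[_ /eqP ? /eqP ? /eqP ?].
exists (o1 w), (o2 w), (pi w); split.
- move=> x xD o1x o2x pix; have [c0 c1 c2] := D0 x xD.
  apply: (coframe_separates dual (DT x xD)).
  by case=> [|[|[|[|[|[|j]]]]]].
- move=> x xker; have [_ w1x w2x] := D0 x (ker_pi21_Dspace xker).
  have [w0x _ _] := D0 x (ker_pi21_Dspace xker).
  have /andP[xT /eqP px] : (x \in tangent F G w) && (pi21 x == 0).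
    by rewrite -mem_ker_pi21.
  have [b eb] := e0.
  (* Contracting the equation for [d w0] with the vertical vector [x] gives a linear relation among
     [w0], [w1], [w2] on the tangent space. These are its coefficients, padded by the default 0 on
     [o1], [o2], [pi]; [ord_max] is the only index of [b]. *)
  pose c : 'rV[R]_6 :=
    \row_i nth 0 [:: ev (b ord_max) x; ev (o1 w) x; ev (o2 w) x] i.
  have c0 : c = 0.
    apply: (coframe_free dual) => v vT.
    have := eb x v xT vT; rewrite (ext_d_contact0_vertical w v px).
    rewrite !big_ord_recr !big_ord0 /= /wedge !mxE /= w0x w1x w2x.
    rewrite !mulr0 !subr0 !mul0r !addr0 !add0r => h.
    by rewrite [RHS]h [RHS]addrC addrA.
  split.
    by have := congr1 (fun A : 'rV_6 => A 0 1) c0; rewrite !mxE.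
  by have := congr1 (fun A : 'rV_6 => A 0 2) c0; rewrite !mxE.
move=> u v uD vD.
have [u0 u1 u2] := D0 u uD; have [v0 v1 v2] := D0 v vD.
have d0 : ext_d (@contact0 R) w u v = 0.
  have [b eb] := e0; rewrite (eb u v (DT u uD) (DT v vD)).
  rewrite big_ord_recr big_ord0 /= (wedge_eq0 _ u0 v0).
  by rewrite (wedge_eq0 _ u1 v1) (wedge_eq0 _ u2 v2) !addr0.
split; first exact: d0.
have [b1 E1] := e1; have [b2 E2] := e2.
have sum0 (b : 'I_3 -> covector R) : \sum_(i < 3)
    wedge (b i) [:: contact0 w; w1 w; w2 w]`_i u v = 0.
  rewrite !big_ord_recr big_ord0 /= (wedge_eq0 _ u0 v0).
  by rewrite (wedge_eq0 _ u1 v1) (wedge_eq0 _ u2 v2) !addr0.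
have := E1 u v (DT u uD) (DT v vD); rewrite sum0 addr0 => <-.
have := E2 u v (DT u uD) (DT v vD); rewrite sum0 addr0 => <-.
exact: (ext_d_transfer Lw oU Uw s1 s2 DE uD vD d0).
Qed.

Lemma not_subv_line (V : {vspace J2 R}) x : (1 < \dim V)%N ->
  exists2 y, y \in V & y \notin <[x]>%VS.
Proof.
move=> V1; apply: contrapT => H.
suff /dimvS : (V <= <[x]>)%VS.
  by rewrite dim_vline leqNgt (leq_ltn_trans (leq_b1 _) V1).
apply/subvP => y yV; apply: contrapT => yx.
by apply: H; exists y; last exact/negP.
Qed.

Lemma transversal_of_finite_type k : (k = TypeII \/ k = TypeIII) ->
  of_type F G k -> transversal_prolongation F G = rank2_prolongation F G.
Proof.
move=> k23 ktype; apply/seteqP; split=> [e [re _]|[w V] rV]; first exact: re.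
split; first exact: rV.
have /= [Lw [VD V2 V0 V1 V2'] ] := rV.
have [ o1 [ o2 [pi [sep vert str] ] ] ] := structure_equations ktype Lw.
have DV x : x \in V -> x \in Dspace F G w by move: x; apply/subvP.
apply/eqP; rewrite -subv0; apply/subvP => e.
rewrite memv_cap memv0 => /andP[eV /= eker]; apply/eqP.
have [ o1e o2e] := vert e eker.
have [pie|pie] := eqVneq (ev pi e) 0; first exact: (sep e (DV e eV)).
have [|y yV /negP[]] := @not_subv_line V e; first by rewrite V2.
have [_ strey] := str e y (DV e eV) (DV y yV).
have [h1 h2] := strey.1 (conj (V1 e y eV yV) (V2' e y eV yV)).
(* As [o1] and [o2] vanish on [e], each structure equation at [(e, y)] reduces to [ev o1 y] or
   [ev o2 y] times the nonzero [ev pi e]. *)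
have [ o1y o2y] : ev o1 y = 0 /\ ev o2 y = 0.
  have cancel (s : R) : 0 * ev pi y - s * ev pi e = 0 -> s = 0.
    rewrite mul0r sub0r => /eqP; rewrite oppr_eq0 mulf_eq0 (negPf pie) orbF.
    by move/eqP.
  by case: k23 h1 h2 => -> /=; rewrite /wedge o1e o2e => /cancel ? /cancel ?.
(* All three coordinates of [z] vanish, which puts [y] on the line of [e], against its choice. *)
pose z := y - (ev pi y / ev pi e) *: e.
have z0 : z = 0.
  apply: sep; last 3 first.
  - by rewrite /z evDr evNr evZr o1e o1y mulr0 subr0.
  - by rewrite /z evDr evNr evZr o2e o2y mulr0 subr0.
  - by rewrite /z evDr evNr evZr divfK// subrr.
  by rewrite /z rpredB// ?rpredZ//; exact: DV.
apply/vlineP; exists (ev pi y / ev pi e).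
by apply/eqP; rewrite -subr_eq0 -/z z0.
Qed.

Lemma not_transversal_of_nonfinite_type k : (k = TypeI \/ k = TypeIV) ->
  of_type F G k -> transversal_prolongation F G <> rank2_prolongation F G.
Proof.
(* Nonemptiness of the locus supplies the base point at which the two prolongations differ. *)
move=> k14 ktype TE; have [_ _ [w Lw] _] := FGreg.
have [ o1 [ o2 [pi [sep vert str] ] ] ] := structure_equations ktype Lw.
pose S := (Dspace F G w :&: annihilated o2)%VS.
have SP x : (x \in S) = (x \in Dspace F G w) && (ev o2 x == 0).
  by rewrite /S memv_cap mem_annihilated.
(* At most 2 because [o1] and [pi] separate the vectors of [S]; at least 2 because four linear
   conditions are imposed on a tangent space of dimension at least 6. *)
have S2 : \dim S = 2.
  apply/anti_leq/andP; split.
    have h1 := dim_cap_annihilated S o1.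
    have h2 := dim_cap_annihilated (S :&: annihilated o1)%VS pi.
    rewrite (leq_trans h1)// ltnS (leq_trans h2)// ltnS leqn0 dimv_eq0 -subv0.
    apply/subvP => x; rewrite 2!memv_cap 2!mem_annihilated SP memv0.
    by move=> /andP[/andP[/andP[xD /eqP h] /eqP ?] /eqP ?]; apply/eqP/sep.
  have hT := dim_tangent F G w.
  have h0 := dim_cap_annihilated (tangent F G w) (contact0 w).
  have h1 := dim_cap_annihilated (tangent F G w :&: annihilated (contact0 w))%VS
    (contact1 w).
  have h2 : (\dim (tangent F G w :&: annihilated (contact0 w)
      :&: annihilated (contact1 w)) <= (\dim (Dspace F G w)).+1)%N.
    by rewrite /Dspace 2!capvA; exact: dim_cap_annihilated.
  have h3 := dim_cap_annihilated (Dspace F G w) o2.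
  have := leq_trans hT h0; rewrite ltnS => /leq_trans/(_ h1).
  by rewrite ltnS => /leq_trans/(_ h2); rewrite ltnS => /leq_trans/(_ h3).
have [e eker e0] := ker_pi21_neq0 F G w.
have eS : e \in S by rewrite SP ker_pi21_Dspace// (vert e eker).2 eqxx.
have intS : integral_element F G w S.
  (* In types (I) and (IV) each right-hand side is zero or has [o2] as a factor. *)
  have str0 a b : a \in S -> b \in S ->
      structure1 k o1 o2 pi a b = 0 /\ structure2 k o1 o2 pi a b = 0.
    rewrite 2!SP => /andP[_ /eqP o2a] /andP[_ /eqP o2b].
    by case: k14 => -> /=; rewrite /wedge o2a o2b !mul0r ?mulr0 subrr.
  have SD a : a \in S -> a \in Dspace F G w by rewrite SP => /andP[].
  split.
  - by apply/subvP.
  - exact: S2.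
  - by move=> a b aS bS; have [] := str a b (SD a aS) (SD b bS).
  - move=> a b aS bS; have [_ h] := str a b (SD a aS) (SD b bS).
    by have [] := h.2 (str0 a b aS bS).
  - move=> a b aS bS; have [_ h] := str a b (SD a aS) (SD b bS).
    by have [] := h.2 (str0 a b aS bS).
have : transversal_prolongation F G (w, S) by rewrite TE; split.
move=> [_ /= S0]; move/eqP: e0; apply; apply/eqP.
by rewrite -memv0 -S0 memv_cap eS eker.
Qed.
End types.

Theorem corollary3p10 (R : realType) (F G : J2 R -> R)
  (hreg : regular_system F G)
  (htype : of_type F G TypeI \/ of_type F G TypeII \/
           of_type F G TypeIII \/ of_type F G TypeIV) :
  (transversal_prolongation F G = rank2_prolongation F G <->
     of_type F G TypeII \/ of_type F G TypeIII) /\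
  (transversal_prolongation F G <> rank2_prolongation F G <->
     of_type F G TypeI \/ of_type F G TypeIV).
Proof.
have t2 := transversal_of_finite_type hreg (or_introl erefl).
have t3 := transversal_of_finite_type hreg (or_intror erefl).
have t1 := not_transversal_of_nonfinite_type hreg (or_introl erefl).
have t4 := not_transversal_of_nonfinite_type hreg (or_intror erefl).
(* Each type decides whether the prolongations agree. Since one of the four holds, equality rules
   out (I) and (IV) and leaves (II) or (III), and inequality does the opposite. *)
tauto.
Qed.
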